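(* Let $G$ be a finite simple connected graph with $m\ge 1$ edges, maximum degree $\Delta$ and minimum degree $\delta$. Then $$\frac{2\Delta\delta^2}{\Delta^2+\delta^2}\sqrt{m R_{-1}(G)}\le GA_1(G)\le \Delta\sqrt{m R_{-1}(G)},$$ and each of the two equalities holds if and only if $G$ is a regular graph.
   Context: For a graph $G$ with vertex set $V(G)$ and edge set $E(G)$, $d_u$ denotes the degree of the vertex $u$. The first geometric-arithmetic index is $GA_1(G)=\sum_{uv\in E(G)}\frac{2\sqrt{d_ud_v}}{d_u+d_v}$. Also $R_{-1}(G)=\sum_{uv\in E(G)}\frac{1}{d_ud_v}$ (the general Randić index $R_\alpha(G)=\sum_{uv\in E(G)}(d_ud_v)^\alpha$ with $\alpha=-1$). *)

(* Defs.v *)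
From mathcomp Require Import all_boot all_order all_algebra.

Set Implicit Arguments.
Unset Strict Implicit.
Unset Printing Implicit Defensive.

Import Order.TTheory GRing.Theory Num.Theory.
Local Open Scope ring_scope.

Record sgraph := SGraph {
  vertex :> finType;
  adj : rel vertex;
  adj_sym : symmetric adj;
  adj_irrefl : irreflexive adj
}.

Section Graph.
Variable G : sgraph.

Definition edges : {set {set G}} :=
  [set [set u; v] | u in G, v in G & adj u v].

Definition deg (u : G) : nat := #|[set v | adj u v]|.

Definition max_deg : nat := (\max_(u : G) deg u)%N.

(* Every degree is at most #|G|, so the default value does not affect the
   minimum as soon as G has a vertex. *)
Definition min_deg : nat := \big[minn/#|G|]_(u : G) deg u.

Definition connected : Prop := forall u v : G, connect (@adj G) u v.

Definition regular : Prop := exists k : nat, forall u : G, deg u = k.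

(* For an edge A = [set u; v] one has u != v, so the product and the sum of
   the degrees over A are d_u d_v and d_u + d_v. *)
Definition deg_prod (A : {set G}) : nat := (\prod_(u in A) deg u)%N.
Definition deg_sum (A : {set G}) : nat := (\sum_(u in A) deg u)%N.

Definition GA1 (R : rcfType) : R :=
  \sum_(A in edges) 2 * Num.sqrt (deg_prod A)%:R / (deg_sum A)%:R.

Definition Randic_m1 (R : rcfType) : R :=
  \sum_(A in edges) 1 / (deg_prod A)%:R.

End Graph.

(* Main.v *)
(** Put [x = 2 sqrt (d_u d_v) / (d_u + d_v)] and [y = 1 / sqrt (d_u d_v)] on an
    edge [uv], so that [GA_1] is the sum of the [x] and [R_{-1}] the sum of the
    [y ^ 2].  The ratio [x / y] is the harmonic mean of [d_u] and [d_v], hence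
    lies between [delta] and [Delta].  The upper bound follows by
    Cauchy-Schwarz.  For the lower bound, [y] lies in [1/Delta, 1/delta], and
    the Polya-Szego reverse of Cauchy-Schwarz gives even the constant
    [2 delta sqrt (Delta delta) / (Delta + delta)], which is strictly larger
    than the required one unless [Delta = delta]. *)
Require Import Defs.
From mathcomp Require Import all_boot all_order all_algebra.
From mathcomp Require Import ring lra.

Set Implicit Arguments.
Unset Strict Implicit.

Import Order.TTheory GRing.Theory Num.Theory.
Local Open Scope ring_scope.

(** With [m = #|E|], [Y] the sum and [Q] the sum of squares, the squares of the deviations
    [m * y i - Y] add up to [m * (m * Q - Y ^+ 2)]. *)
Lemma sqr_sum_le_card_mul (R : realFieldType) (I : finType) (E : {set I})
    (y : I -> R) :
  (\sum_(i in E) y i) ^+ 2 <= #|E|%:R * \sum_(i in E) y i ^+ 2.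
Proof.
have [->|E0] := eqVneq E set0; first by rewrite !big_set0 cards0 mul0r expr0n.
have m0 : 0 < #|E|%:R :> R by rewrite ltr0n card_gt0.
set m : R := #|E|%:R in m0 *; set Y := \sum_(i in E) y i.
have : 0 <= \sum_(i in E) (m * y i - Y) ^+ 2.
  by apply: sumr_ge0 => i _; exact: sqr_ge0.
rewrite (eq_bigr (fun i =>
    m ^+ 2 * y i ^+ 2 + (- (2 * m * Y) * y i + Y ^+ 2))); last first.
  by move=> i _; ring.
rewrite !big_split /= -!mulr_sumr -/Y sumr_const -mulr_natl -/m => H.
by rewrite -subr_ge0 -(pmulr_rge0 _ m0); move: H; congr (0 <= _); ring.
Qed.

(* Sum the inequality [(D * y - 1) * (1 - d * y) >= 0]. *)
Lemma reverse_sqr_sum (R : rcfType) (I : finType) (E : {set I})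
    (y : I -> R) (d D : R) :
    0 <= d -> 0 <= D -> {in E, forall i, d * y i <= 1 /\ 1 <= D * y i} ->
  2 * Num.sqrt (D * d) * Num.sqrt (#|E|%:R * \sum_(i in E) y i ^+ 2)
    <= (D + d) * \sum_(i in E) y i.
Proof.
move=> d0 D0 yP.
set Q := \sum_(i in E) y i ^+ 2; set m : R := #|E|%:R.
have Q0 : 0 <= Q by apply: sumr_ge0 => i _; exact: sqr_ge0.
have m0 : 0 <= m by rewrite ler0n.
(* The left side is at most [D * d * Q + m] by AM-GM; the pointwise inequality is then summed. *)
apply: (@le_trans _ _ (D * d * Q + m)).
  have := sqr_ge0 (Num.sqrt (D * d) * Num.sqrt Q - Num.sqrt m).
  rewrite sqrrB exprMn !sqr_sqrtr ?mulr_ge0 // (sqrtrM Q m0); lra.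
rewrite /Q /m -sumr_const !mulr_sumr -big_split /=.
apply: ler_sum => i /yP[dy Dy].
have := mulr_ge0 (_ : 0 <= D * y i - 1) (_ : 0 <= 1 - d * y i).
by rewrite !subr_ge0 => /(_ Dy dy); lra.
Qed.

(** By AM-GM the first term is at most [(a + b) ^+ 2 / 2]. The explicit slack [(a - b) ^+ 2 / 2]
    serves to settle equality in the lower bound. *)
Lemma sqrtM_mul_add_le (R : rcfType) (a b : R) :
    0 <= a -> 0 <= b ->
  Num.sqrt (a * b) * (a + b) + (a - b) ^+ 2 / 2 <= a ^+ 2 + b ^+ 2.
Proof.
move=> a0 b0; have c0 := sqrtr_ge0 (a * b).
have cE : Num.sqrt (a * b) ^+ 2 = a * b by rewrite sqr_sqrtr ?mulr_ge0.
suff : Num.sqrt (a * b) <= (a + b) / 2 by nra.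
rewrite -(ler_pXn2r (n := 2)) ?nnegrE ?divr_ge0 ?addr_ge0 // cE.
by have := sqr_ge0 (a - b); nra.
Qed.

Section Degrees.
Variable G : sgraph.

Lemma edgesP (A : {set G}) : A \in edges G ->
  exists u v : G, [/\ adj u v, A = [set u; v],
    deg_prod A = (deg u * deg v)%N & deg_sum A = (deg u + deg v)%N].
Proof.
case/imset2P => u v _; rewrite inE => /andP[_ uv] ->.
have uNv : u \notin [set v].
  by rewrite inE; apply: contraTneq uv => ->; rewrite adj_irrefl.
by exists u, v; rewrite /deg_prod /deg_sum !big_setU1 ?big_set1.
Qed.

Lemma mem_edges (u v : G) : adj u v -> [set u; v] \in edges G.
Proof. by move=> uv; apply/imset2P; exists u v; rewrite ?inE. Qed.

Lemma deg_le_max (u : G) : (deg u <= max_deg G)%N.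
Proof. exact: (leq_bigmax u). Qed.

Lemma min_le_deg (u : G) : (min_deg G <= deg u)%N.
Proof.
rewrite /min_deg; have := mem_index_enum u.
elim: index_enum => //= a s IHs; rewrite inE big_cons geq_min.
by case/predU1P => [->|/IHs->]; rewrite ?leqnn ?orbT.
Qed.

(** The bound on [#|G|] takes care of the default value of the minimum. *)
Lemma le_min_deg (k : nat) : (k <= #|G|)%N -> (forall u : G, k <= deg u)%N ->
  (k <= min_deg G)%N.
Proof.
move=> kG kdeg; rewrite /min_deg; elim/big_ind: _ => // a b ka kb.
by rewrite leq_min ka.
Qed.

(** An edge supplies a vertex other than [u], and the first step of a path to it is a neighbour of
    [u]. *)
Lemma exists_adj (u : G) : connected G -> (1 <= #|edges G|)%N ->
  exists v, adj u v.
Proof.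
move=> cG; rewrite card_gt0 => /set0Pn[A /edgesP[a [b [ab _ _ _]]]].
have [w uNw] : exists w, w != u.
  have [aE|] := eqVneq a u; last by exists a.
  by exists b; apply: contraTneq ab => ->; rewrite aE adj_irrefl.
have /connectP[[|v p] /= pth E] := cG u w; first by rewrite E eqxx in uNw.
by case/andP: pth => uv _; exists v.
Qed.

Lemma min_deg_gt0 : connected G -> (1 <= #|edges G|)%N -> (0 < min_deg G)%N.
Proof.
move=> cG eG; apply: le_min_deg => [|u]; last first.
  by have [v uv] := exists_adj u cG eG; apply/card_gt0P; exists v; rewrite inE.
have /set0Pn[A /edgesP[a _]] : edges G != set0 by rewrite -card_gt0.
by apply/card_gt0P; exists a.
Qed.

Lemma min_eq_max_regular : min_deg G = max_deg G -> regular G.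
Proof.
move=> dD; exists (max_deg G) => u.
by apply/eqP; rewrite eqn_leq deg_le_max -dD min_le_deg.
Qed.

Lemma regular_min_eq_max (u : G) : regular G -> min_deg G = max_deg G.
Proof.
case=> k kP; apply/eqP; rewrite eqn_leq.
rewrite (leq_trans (min_le_deg u) (deg_le_max u)) /=.
have -> : max_deg G = k.
  apply/eqP; rewrite eqn_leq -{2}(kP u) deg_le_max andbT.
  by apply/bigmax_leqP => v _; rewrite kP.
by apply: le_min_deg => [|v]; rewrite -?(kP u) ?max_card // !kP.
Qed.

End Degrees.

Theorem theorem2p11 (R : rcfType) (G : sgraph) :
  connected G -> (1 <= #|edges G|)%N ->
  let m : R := #|edges G|%:R in
  let D : R := (max_deg G)%:R in
  let d : R := (min_deg G)%:R in
  let lower : R :=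
    2 * D * d ^+ 2 / (D ^+ 2 + d ^+ 2) * Num.sqrt (m * Randic_m1 G R) in
  let upper : R := D * Num.sqrt (m * Randic_m1 G R) in
  [/\ lower <= GA1 G R,
      GA1 G R <= upper,
      lower = GA1 G R <-> regular G
    & GA1 G R = upper <-> regular G].
Proof.
move=> cG eG m D d lower upper.
pose y (A : {set G}) : R := (Num.sqrt (deg_prod A)%:R)^-1.
pose x (A : {set G}) : R := 2 * Num.sqrt (deg_prod A)%:R / (deg_sum A)%:R.
have d0 : 0 < d by rewrite ltr0n min_deg_gt0.
have m0 : 0 < m by rewrite ltr0n.
have [u0 _] : exists u : G, true.
  have /set0Pn[A /edgesP[a _]] : edges G != set0 by rewrite -card_gt0.
  by exists a.
have dD : d <= D by rewrite ler_nat (leq_trans (min_le_deg u0)) ?deg_le_max.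
have D0 : 0 < D := lt_le_trans d0 dD.
have degP (u : G) : d <= (deg u)%:R <= D.
  by rewrite !ler_nat min_le_deg deg_le_max.
(* Polynomial identities for [x] and [y], free of roots and quotients; the last one makes
   [x A / y A] the harmonic mean of the two degrees. *)
have edgeP A : A \in edges G -> exists u v : G,
    [/\ A = [set u; v], 0 < y A, y A ^+ 2 * ((deg u)%:R * (deg v)%:R) = 1
      & x A * ((deg u)%:R + (deg v)%:R) = 2 * ((deg u)%:R * (deg v)%:R) * y A].
  case/edgesP => u [v [_ AE pE sE]]; exists u, v.
  have /andP[du _] := degP u; have /andP[dv _] := degP v.
  have a0 := lt_le_trans d0 du; have b0 := lt_le_trans d0 dv.
  have p0 : 0 < (deg u)%:R * (deg v)%:R :> R by rewrite mulr_gt0.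
  have q0 : 0 < Num.sqrt ((deg u)%:R * (deg v)%:R) :> R by rewrite sqrtr_gt0.
  have qE := sqr_sqrtr (ltW p0).
  rewrite /x /y pE sE natrM natrD; split => //.
  - by rewrite invr_gt0.
  - by rewrite exprVn qE mulVf ?gt_eqF.
  - by rewrite -{2}qE; field; rewrite !gt_eqF // addr_gt0.
have y0 A : A \in edges G -> 0 < y A by case/edgeP => u [v []].
have yP : {in edges G, forall A, d * y A <= 1 /\ 1 <= D * y A}.
  move=> A /edgeP[u [v [_ yA yE _]]].
  have /andP[du uD] := degP u; have /andP[dv vD] := degP v.
  have ab1 := ler_pM (ltW d0) (ltW d0) du dv.
  have ab2 : (deg u)%:R * (deg v)%:R <= D * D.
    by apply: ler_pM; rewrite ?ler0n.
  have yy := mulr_gt0 yA yA; have Dy := mulr_gt0 D0 yA.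
  have dy := mulr_gt0 d0 yA.
  have h1 := ler_wpM2l (ltW yy) ab1; have h2 := ler_wpM2l (ltW yy) ab2.
  split; rewrite -(ler_pXn2r (n := 2)) ?nnegrE ?ler01 ?(ltW dy) ?(ltW Dy) //;
    by rewrite expr1n exprMn -yE; lra.
have xyP A : A \in edges G -> d * y A <= x A <= D * y A.
  case/edgeP => u [v [_ yA _ xE]].
  have /andP[du uD] := degP u; have /andP[dv vD] := degP v.
  have a0 := lt_le_trans d0 du; have b0 := lt_le_trans d0 dv.
  have s0 := addr_gt0 a0 b0.
  (* With [a], [b] the degrees, clearing [a + b] and cancelling [y A] leaves
     [d (a + b) <= 2 a b <= D (a + b)]. *)
  rewrite -(ler_pM2r s0) -[X in _ && X](ler_pM2r s0) xE
    -!mulrA ![y A * _]mulrC !mulrA.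
  by rewrite !(ler_pM2r yA); apply/andP; split; nra.
have RE : Randic_m1 G R = \sum_(A in edges G) y A ^+ 2.
  apply: eq_bigr => A _.
  by rewrite /y exprVn sqr_sqrtr ?ler0n // div1r.
have GE : GA1 G R = \sum_(A in edges G) x A by [].
rewrite /lower /upper GE RE.
set Q := \sum_(A in edges G) y A ^+ 2; set X := \sum_(A in edges G) x A.
set S := Num.sqrt (m * Q); pose Y := \sum_(A in edges G) y A.
have Y0 : 0 < Y.
  have /set0Pn[A eA] : edges G != set0 by rewrite -card_gt0.
  rewrite /Y (bigD1 A) //= ltr_pwDl ?y0 //.
  by apply: sumr_ge0 => B /andP[/y0/ltW].
have YS : Y <= S.
  have Q0 : 0 <= Q by apply: sumr_ge0 => i _; exact: sqr_ge0.
  rewrite -(ler_pXn2r (n := 2)) ?nnegrE ?sqrtr_ge0 ?(ltW Y0) //.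
  by rewrite sqr_sqrtr ?mulr_ge0 ?(ltW m0) ?sqr_sum_le_card_mul.
have dYX : d * Y <= X.
  by rewrite mulr_sumr; apply: ler_sum => A /xyP/andP[].
have XDY : X <= D * Y.
  by rewrite mulr_sumr; apply: ler_sum => A /xyP/andP[].
have XDS : X <= D * S by rewrite (le_trans XDY) // ler_pM2l.
have K0 : 0 < D ^+ 2 + d ^+ 2 by rewrite addr_gt0 ?exprn_gt0.
(* The lower bound with its slack kept: multiply the reverse Cauchy-Schwarz inequality by
   [sqrt (D d)], apply [sqrtM_mul_add_le], then multiply by [d] and use [d * Y <= X]. *)
have gap : 2 * D * d ^+ 2 * S + d * Y * ((D - d) ^+ 2 / 2)
           <= X * (D ^+ 2 + d ^+ 2).
  have SY : 2 * Num.sqrt (D * d) * S <= (D + d) * Y.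
    by apply: reverse_sqr_sum yP; exact: ltW.
  have cK := @sqrtM_mul_add_le R D d (ltW D0) (ltW d0).
  have cE : Num.sqrt (D * d) ^+ 2 = D * d by rewrite sqr_sqrtr // mulr_ge0 ?ltW.
  have c0 := sqrtr_ge0 (D * d).
  set c := Num.sqrt (D * d) in SY cK cE c0.
  have h1 : 2 * (D * d) * S <= c * ((D + d) * Y).
    by have := ler_wpM2l c0 SY; rewrite -cE; lra.
  have h2 := ler_wpM2r (ltW Y0) cK.
  have h3 : d * (2 * (D * d) * S + Y * ((D - d) ^+ 2 / 2))
            <= d * (Y * (D ^+ 2 + d ^+ 2)) by rewrite ler_pM2l //; lra.
  have h4 := ler_wpM2r (ltW K0) dYX.
  lra.
have Dd_reg : d = D -> regular G.
  by move/eqP; rewrite eqr_nat => /eqP; exact: min_eq_max_regular.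
have lowerE : 2 * D * d ^+ 2 / (D ^+ 2 + d ^+ 2) * S
              = 2 * D * d ^+ 2 * S / (D ^+ 2 + d ^+ 2) by rewrite mulrAC.
have lowX : 2 * D * d ^+ 2 / (D ^+ 2 + d ^+ 2) * S <= X.
  rewrite lowerE ler_pdivrMr //; apply: le_trans gap.
  by rewrite lerDl (mulr_ge0 (ltW (mulr_gt0 d0 Y0))) // divr_ge0 ?sqr_ge0.
have reg_eq : regular G ->
    2 * D * d ^+ 2 / (D ^+ 2 + d ^+ 2) * S = X /\ X = D * S.
  move/(regular_min_eq_max u0) => dDn.
  (* For [d = D] the two bounds coincide and squeeze [X]. *)
  have lowE : 2 * D * d ^+ 2 / (D ^+ 2 + d ^+ 2) * S = D * S.
    by rewrite /d dDn -/D; field; rewrite gt_eqF //; nra.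
  suff XE : X = D * S by rewrite lowE -XE.
  by apply/eqP; rewrite eq_le XDS -lowE lowX.
split => //.
(* Equality leaves no room for the slack in [gap], so [(D - d) ^+ 2] vanishes. *)
- split=> [eqX|/reg_eq[]//]; apply: Dd_reg; apply/eqP; rewrite eq_sym -subr_eq0.
  have dY0 := mulr_gt0 d0 Y0.
  move: gap; rewrite -eqX lowerE (divfK (lt0r_neq0 K0)) => gap.
  have : d * Y * ((D - d) ^+ 2 / 2) <= 0 by lra.
  rewrite pmulr_rle0 // => sqr_le0.
  by rewrite -sqrf_eq0 eq_le sqr_ge0 andbT; lra.
- split=> [eqX|/reg_eq[]//]; exists (max_deg G) => u.
  (* Since [X <= D * Y <= D * S], equality of the ends gives [X = D * Y], so every nonnegative term
     [D * y A - x A] is zero, in particular on an edge at [u]. *)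
  have XE : X = D * Y by apply/eqP; rewrite eq_le XDY eqX ler_pM2l.
  have [v /mem_edges eA] := exists_adj u cG eG.
  have sum0 : \sum_(A in edges G) (D * y A - x A) = 0.
    by rewrite sumrB -mulr_sumr -/X -/Y XE subrr.
  have /psumr_eq0P/(_ sum0 _ eA) xE : forall A,
      A \in edges G -> 0 <= D * y A - x A.
    by move=> A /xyP/andP[_]; rewrite subr_ge0.
  have [a [b [AE yA _ xsE]]] := edgeP _ eA.
  have /andP[da aD] := degP a; have /andP[db bD] := degP b.
  have uab : u \in [set a; b] by rewrite -AE !inE eqxx.
  have E : D * ((deg a)%:R + (deg b)%:R) = 2 * ((deg a)%:R * (deg b)%:R).
    apply: (mulIf (lt0r_neq0 yA)); rewrite -xsE.
    have -> : x [set u; v] = D * y [set u; v] by lra.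
    by ring.
  suff [aE bE] : (deg a)%:R = D /\ (deg b)%:R = D.
    apply/eqP; rewrite -(eqr_nat R); move: uab.
    by rewrite !inE => /orP[]/eqP->; apply/eqP.
  (* With [a], [b] now standing for their degrees, [E] reads [a (D - b) + b (D - a) = 0], a sum of
     nonnegative terms with [a] and [b] positive. *)
  have a0 := lt_le_trans d0 da; have b0 := lt_le_trans d0 db.
  by split; nra.
Qed.
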